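(* Let $a:\mathbb{R}^d\to\mathbb{R}$ satisfy: $a(x)\ge0$, $a(x)=a(-x)$, $a\in L^\infty(\mathbb{R}^d)\cap L^1(\mathbb{R}^d)$, $\int_{\mathbb{R}^d}a(x)\,dx=1$, $\int_{\mathbb{R}^d}|x|^2a(x)\,dx<\infty$, and, for some $p\ge1$ and some constants $C_1,b>0$, $0\le a(x)\le C_1e^{-b|x|^p}$ for all $x\in\mathbb{R}^d$. Let $v(x,t)=e^{-t}\sum_{k=1}^{\infty}\frac{t^k a^{\ast k}(x)}{k!}$. Then for $|x|=r t^{\frac{1+\delta}{2}}(1+o(1))$ with $\delta>1$ and $r>0$ the following asymptotic upper bound holds: $$v(x,t)\le e^{-c_p\,t^{\frac{\delta+1}{2}}(\ln t)^{\frac{p-1}{p}}(1+o(1))},\qquad \text{as } t\to\infty,$$ where the constant $c_p=c_p(b,r)>0$ depends on $b$, $r$ and $p$. If in addition $a\in C_0(\mathbb{R}^d)$ and $\operatorname{supp}a\subset\{x\in\mathbb{R}^d:\ |x|\le\mu\}$ for some $\mu>0$, where $\mu$ is taken to be the minimal number with this property, then for $|x|=r t^{\frac{\delta+1}{2}}(1+o(1))$ with $\delta>1$ $$v(x,t)\le e^{-\tilde c(\mu)\,t^{\frac{\delta+1}{2}}\ln t\,(1+o(1))},\qquad \text{as } t\to\infty,$$ where $\tilde c(\mu)=\frac{(\delta-1)r}{2\mu}$.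
   Context: $a^{\ast k}$ is the $k$-fold convolution power of $a$ ($a^{\ast1}=a$). The function $v$ is the regular part of the fundamental solution $e^{-t}\delta_0(x)+v(x,t)$ (with $\delta_0$ the Dirac mass at the origin) of the equation $\partial_t u=a\ast u-u$ on $\mathbb{R}^d$. Here $x=x(t)\in\mathbb{R}^d$, and $|x|=rt^{(1+\delta)/2}(1+o(1))$ means $t^{-(1+\delta)/2}|x(t)|\to r$ as $t\to\infty$. An inequality $v\le e^{-g(t)(1+o(1))}$ means that there is $\varepsilon(t)\to0$ as $t\to\infty$ with $v\le e^{-g(t)(1+\varepsilon(t))}$ for large $t$.
   Formalization: The constant c_p is allowed to depend on δ as well as on b, r and p; a positive constant independent of δ is impossible, since for Gaussian kernels (p = 2) the optimal constant tends to 0 as δ → 1. *)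

(* Defs.v *)
From HB Require Import structures.
From mathcomp Require Import all_boot all_order all_algebra.
From mathcomp Require Import all_classical all_reals all_analysis.

Set Implicit Arguments.
Unset Strict Implicit.
Unset Printing Implicit Defensive.

Import Order.TTheory GRing.Theory Num.Theory.
Import numFieldNormedType.Exports.

Local Open Scope classical_set_scope.
Local Open Scope ring_scope.

(* The sigma-algebra generated by the coordinates, as for [n.-tuple T]; on
   ['rV[R]_n] with [R : realType] it is the Borel sigma-algebra. *)
Section measurable_rV.
Context {d} {T : measurableType d} (n : nat).

Let coors : 'I_n -> 'rV[T]_n -> T := fun i x => x ord0 i.

Let rV_set0 : g_sigma_preimage coors set0.
Proof. exact: sigma_algebra0. Qed.

Let rV_setC A : g_sigma_preimage coors A -> g_sigma_preimage coors (~` A).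
Proof. exact: sigma_algebraC. Qed.

Let rV_bigcup (F : _^nat) : (forall i, g_sigma_preimage coors (F i)) ->
  g_sigma_preimage coors (\bigcup_i (F i)).
Proof. exact: sigma_algebra_bigcup. Qed.

HB.instance Definition _ := @isMeasurable.Build (measure_tuple_display d)
  'rV[T]_n (g_sigma_preimage coors) rV_set0 rV_setC rV_bigcup.

End measurable_rV.

Section lebesgue_measure_rV.
Context {R : realType}.

Definition cons_rV n (p : measurableTypeR R * 'rV[R]_n) : 'rV[R]_n.+1 :=
  \row_i oapp (p.2 ord0) p.1 (unlift ord0 i).

Lemma measurable_coord n (i : 'I_n) :
  measurable_fun [set: 'rV[R]_n] (fun x : 'rV[R]_n => x ord0 i).
Proof.
move=> _ Y mY; rewrite setTI; apply: sub_sigma_algebra => /=.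
rewrite -bigcup_seq/=; exists i => /=; first by rewrite mem_index_enum.
by exists Y => //; rewrite setTI.
Qed.

Lemma measurable_fun_coordP d (T : measurableType d) n (f : T -> 'rV[R]_n) :
  (forall i, measurable_fun [set: T] (fun t => f t ord0 i)) ->
  measurable_fun [set: T] f.
Proof.
move=> mf _ A mA.
have : g_sigma_preimage (fun i t => f t ord0 i) `<=` measurable.
  apply: smallest_sub; first exact: sigma_algebra_measurable.
  rewrite -bigcup_seq; apply: bigcup_sub => i _ _ [B mB <-].
  exact: mf.
apply.
by rewrite (g_sigma_preimage_comp (fun i (x : 'rV[R]_n) => x ord0 i)); exists A.
Qed.

Lemma measurable_cons_rV n : measurable_fun [set: _] (@cons_rV n).
Proof.
apply: measurable_fun_coordP => i; rewrite /cons_rV.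
have [j ->|->] := unliftP ord0 i.
  rewrite [X in measurable_fun _ X](_ : _ = (fun v : 'rV[R]_n => v ord0 j) \o snd).
    by apply: measurableT_comp; [exact: measurable_coord|exact: measurable_snd].
  by apply/funext => -[x v] /=; rewrite mxE liftK.
rewrite [X in measurable_fun _ X](_ : _ = fst).
  exact: measurable_fst.
by apply/funext => -[x v] /=; rewrite mxE unlift_none.
Qed.

Section lebesgue_rV_step.
Context n (m : {sigma_finite_measure set 'rV[R]_n -> \bar R}).
Local Open Scope ereal_scope.

Definition lebesgue_rV_step : set 'rV[R]_n.+1 -> \bar R :=
  pushforward (@lebesgue_measure R \x m) (@cons_rV n).

Let pf : {measure set 'rV[R]_n.+1 -> \bar R} :=
  measure_function_pushforward__canonical__measure_function_Measure
    (@lebesgue_measure R \x m) (@measurable_cons_rV n).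

Let step0 : lebesgue_rV_step set0 = 0.
Proof. exact: (measure0 pf). Qed.

Let step_ge0 A : 0 <= lebesgue_rV_step A.
Proof. exact: (measure_ge0 pf). Qed.

Let step_sigma_additive : semi_sigma_additive lebesgue_rV_step.
Proof. exact: (@measure_semi_sigma_additive _ _ _ pf). Qed.

HB.instance Definition _ := isMeasure.Build _ _ _ lebesgue_rV_step
  step0 step_ge0 step_sigma_additive.

Let split_rV (x : 'rV[R]_n.+1) : measurableTypeR R * 'rV[R]_n :=
  (x ord0 ord0, \row_i x ord0 (lift ord0 i))%R.

Let measurable_split_rV : measurable_fun [set: _] split_rV.
Proof.
apply/measurable_fun_pairP; split; first exact: measurable_coord.
apply: measurable_fun_coordP => i.
rewrite [X in measurable_fun _ X](_ : _ =
  (fun x : 'rV[R]_n.+1 => x ord0 (lift ord0 i))); first exact: measurable_coord.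
by apply/funext => x /=; rewrite mxE.
Qed.

Let cons_rVK : cancel (@cons_rV n) split_rV.
Proof.
move=> [x v]; rewrite /split_rV /cons_rV /=; congr pair.
  by rewrite mxE unlift_none.
by apply/rowP => i; rewrite !mxE liftK.
Qed.

Let step_sigma_finite : sigma_finite setT lebesgue_rV_step.
Proof.
have /sigma_finiteP[F [TF ndF Foo]] := sigma_finiteT (@lebesgue_measure R).
have /sigma_finiteP[G [TG ndG Goo]] := sigma_finiteT m.
exists (fun k => split_rV @^-1` (F k `*` G k)).
  rewrite -preimage_bigcup; apply/esym; rewrite -subTset => x _.
  have [k _ Fk] : (\bigcup_k F k) (split_rV x).1 by rewrite -TF.
  have [l _ Gl] : (\bigcup_k G k) (split_rV x).2 by rewrite -TG.
  exists (maxn k l) => //; split.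
    by move: Fk; exact/subsetPset/ndF/leq_maxl.
  by move: Gl; exact/subsetPset/ndG/leq_maxr.
move=> k; have [mF Fk] := Foo k; have [mG Gk] := Goo k.
have mFG := measurableX mF mG; split.
  by rewrite -[X in measurable X]setTI; exact: measurable_split_rV.
rewrite /lebesgue_rV_step /pushforward -comp_preimage.
rewrite (_ : _ \o _ = id); last by apply/funext => p; exact: cons_rVK.
by rewrite preimage_id product_measure1E// lte_mul_pinfty// ge0_fin_numE.
Qed.

HB.instance Definition _ := Measure_isSigmaFinite.Build _ _ _ lebesgue_rV_step
  step_sigma_finite.

End lebesgue_rV_step.

(* Lebesgue measure on R^n, as the iterated product of the one-dimensional one
   carried along (x, v) |-> the row x followed by v; see [lebesgue_rV_box]. *)
Fixpoint lebesgue_rV n : {sigma_finite_measure set 'rV[R]_n -> \bar R} :=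
  match n with
  | 0 => \d_(0 : 'rV[R]_0)
  | n'.+1 => lebesgue_rV_step (lebesgue_rV n')
  end.

Lemma lebesgue_rV_box n (A : 'I_n -> set (measurableTypeR R)) :
  (forall i, measurable (A i)) ->
  lebesgue_rV n [set x | forall i, A i (x ord0 i)] =
  (\prod_(i < n) lebesgue_measure (A i))%E.
Proof.
elim: n A => [|n IH] A mA /=.
  by rewrite big_ord0 diracE mem_set// => -[].
have mB : measurable [set x : 'rV[R]_n | forall i, A (lift ord0 i) (x ord0 i)].
  rewrite (_ : mkset _ = \bigcap_(i in [set: 'I_n])
      ((fun x : 'rV[R]_n => x ord0 i) @^-1` A (lift ord0 i))).
    apply: fin_bigcap_measurable => // i _.
    by rewrite -[X in measurable X]setTI; apply: (@measurable_coord n i measurableT); exact: mA.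
  by apply/seteqP; split=> [x Ax i _|x Ax i]; [exact: Ax|exact: (Ax i I)].
rewrite big_ord_recl -IH// -product_measure1E//.
rewrite /lebesgue_rV_step /pushforward; congr (_ _).
apply/seteqP; split=> -[x v] /=.
  move=> Axv; split => [|i]; first by have := Axv ord0; rewrite mxE unlift_none.
  by have := Axv (lift ord0 i); rewrite mxE liftK.
move=> [Ax Av] i; rewrite mxE; case: unliftP => [j ->|->] //=.
Qed.

End lebesgue_measure_rV.

Section kernel.
Context {R : realType} {d : nat}.
Implicit Types (a : 'rV[R]_d -> R) (x : 'rV[R]_d).

(* The library norm [`|x|] on row vectors is the sup norm. *)
Definition enorm x : R := Num.sqrt (\sum_(i < d) x ord0 i ^+ 2).

Definition supp a : set 'rV[R]_d := closure [set x | a x != 0].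

Record jump_density a : Prop := JumpDensity {
  jump_ge0 : forall x, 0 <= a x;
  jump_sym : forall x, a x = a (- x);
  jump_Loo : a \in Lfun (@lebesgue_rV R d) +oo%E;
  jump_L1 : a \in Lfun (@lebesgue_rV R d) 1%E;
  jump_int : (\int[@lebesgue_rV R d]_x (a x)%:E = 1)%E;
  jump_moment2 : (\int[@lebesgue_rV R d]_x (enorm x ^+ 2 * a x)%:E < +oo)%E
}.

Definition exp_decay a (C b p : R) : Prop :=
  forall x, 0 <= a x <= C * expR (- b * enorm x `^ p).

(* Continuous with compact support. *)
Definition C0 a : Prop := continuous a /\ compact (supp a).

Definition supp_radius a (mu : R) : Prop :=
  supp a `<=` [set x | enorm x <= mu] /\
  (forall m, supp a `<=` [set x | enorm x <= m] -> mu <= m).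

(* Convolution powers and [v] take values in [\bar R]: for a nonnegative kernel
   every integral and series below is then meaningful without a prior proof of
   convergence. *)
Definition conv (f g : 'rV[R]_d -> \bar R) x : \bar R :=
  (\int[@lebesgue_rV R d]_y (f (x - y)%R * g y))%E.

(* The [k]-fold convolution power, for [k >= 1]. *)
Definition conv_pow a k : 'rV[R]_d -> \bar R :=
  iter k.-1 (fun f => conv f (EFin \o a)) (EFin \o a).

Definition fund_sol_reg a x (t : R) : \bar R :=
  ((expR (- t))%:E *
   \sum_(1 <= k <oo) ((t ^+ k)%:E * conv_pow a k x * (k`!%:R^-1)%:E))%E.

(* |x(t)| = r t^((1 + delta) / 2) (1 + o(1)) as t -> +oo *)
Definition on_scale (delta r : R) (x : R -> 'rV[R]_d) : Prop :=
  t `^ (- ((1 + delta) / 2)) * enorm (x t) @[t --> +oo] --> r.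

End kernel.

(* f(t) <= exp(- g(t) (1 + o(1))) as t -> +oo *)
Definition le_exp_asymp {R : realType} (f : R -> \bar R) (g : R -> R) : Prop :=
  exists eps : R -> R, eps t @[t --> +oo] --> 0 /\
    \forall t \near +oo, (f t <= (expR (- (g t * (1 + eps t))))%:E)%E.

(* Main.v *)
Require Import Defs.
From HB Require Import structures.
From mathcomp Require Import all_boot all_order all_algebra.
From mathcomp Require Import all_classical all_reals all_analysis.
From mathcomp Require Import measurable_realfun ring lra.

Import Order.TTheory GRing.Theory Num.Theory.
Import numFieldNormedType.Exports.

Local Open Scope classical_set_scope.
Local Open Scope ring_scope.

(** The estimate is a Chernoff bound.  Multiplying [a] by the exponential
    [y |-> exp (u . y)] commutes with convolution, because [u . x] splits as
    [u . (x - y) + u . y]; so if the tilted kernel has both supremum and integral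
    at most [N], then [a^{*k}(x) exp (u . x) <= N^k] for all [k >= 1].  Summing
    against [t^k / k!] and dropping [e^{-t} <= 1] gives
    [v(x, t) <= exp (- u . x + t N)] ([fund_sol_reg_le_tilt]).  With [u] pointing
    in the direction of [x] and of length [l], this is [exp (- l |x| + t N(l))].

    It remains to choose [l = l(t)] as large as possible while [t N(l)] stays
    negligible compared with [l |x| ~ l r t^((1 + delta) / 2)].  Take
    [l = kappa (ln t)^theta].  If [l] is such that the tilted kernel is at most
    [t^s w] for a fixed bounded integrable envelope [w], then [N = C t^s], and the
    condition is that [t^(1 + s)] be negligible compared with
    [t^((1 + delta) / 2) (ln t)^theta]; the resulting rate is
    [kappa r t^((1 + delta) / 2) (ln t)^theta] ([le_exp_asymp_fund_sol]).

    - For [a <= C1 exp (- b |y|^p)], the inequality of Young type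
      [min s b' L^((p - 1) / p) q <= s L + b' q^p] ([young_min]), at [L = ln t],
      [q = |y|] and [b' = b / 2], allows [theta = (p - 1) / p] with
      [kappa = min s (b / 2)].  Half of the decay is left over for the envelope,
      and any [0 < s < (delta - 1) / 2] is admissible, even at [p = 1] where
      the logarithm disappears.
    - For [a] supported in [|y| <= mu], the tilt is at most
      [exp (l mu)], so [theta = 1] and [kappa = s / mu] with envelope [a] itself.
      Here the borderline [s = (delta - 1) / 2] is still admissible, since the
      factor [ln t] alone makes [t^(1 + s)] negligible; this gives the constant
      [(delta - 1) r / (2 mu)]. *)

(** * Linear exponential tilts on Euclidean space *)

Definition dotp {R : realType} {d} (u v : 'rV[R]_d) : R :=
  \sum_(i < d) u ord0 i * v ord0 i.

Lemma enorm_ge0 (R : realType) d (x : 'rV[R]_d) : 0 <= enorm x.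
Proof. exact: sqrtr_ge0. Qed.

Lemma sqr_enorm (R : realType) d (x : 'rV[R]_d) :
  enorm x ^+ 2 = \sum_(i < d) x ord0 i ^+ 2.
Proof. by rewrite sqr_sqrtr// sumr_ge0// => i _; exact: sqr_ge0. Qed.

Lemma le_coord_enorm (R : realType) d (x : 'rV[R]_d) i : `|x ord0 i| <= enorm x.
Proof.
rewrite -ler_sqr ?nnegrE ?enorm_ge0// real_normK ?num_real// sqr_enorm.
by rewrite (bigD1 i)//= lerDl sumr_ge0// => j _; exact: sqr_ge0.
Qed.

Lemma sum_coord_le_enorm (R : realType) d (x : 'rV[R]_d) :
  \sum_(i < d) `|x ord0 i| <= d%:R * enorm x.
Proof.
rewrite mulr_natl -[d in _ *+ d]card_ord -sumr_const.
by apply: ler_sum => i _; exact: le_coord_enorm.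
Qed.

Lemma dotp_le_enorm (R : realType) d (u v : 'rV[R]_d) :
  dotp u v <= enorm u * enorm v.
Proof.
have coord0 (z : 'rV[R]_d) i : enorm z = 0 -> z ord0 i = 0.
  by move=> z0; apply/eqP; rewrite -normr_le0 -z0 le_coord_enorm.
have [u0|u0] := eqVneq (enorm u) 0.
  by rewrite u0 mul0r /dotp big1// => i _; rewrite coord0// mul0r.
have [v0|v0] := eqVneq (enorm v) 0.
  by rewrite v0 mulr0 /dotp big1// => i _; rewrite (coord0 v)// mulr0.
have uv0 : 0 < enorm u * enorm v by rewrite mulr_gt0// lt_def ?u0 ?v0 enorm_ge0.
(* Expands to [2 |u| |v| (|u| |v| - u . v)]. *)
have : 0 <= \sum_(i < d) (enorm v * u ord0 i - enorm u * v ord0 i) ^+ 2.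
  by rewrite sumr_ge0// => i _; exact: sqr_ge0.
rewrite (eq_bigr (fun i => enorm v ^+ 2 * u ord0 i ^+ 2
    + enorm u ^+ 2 * v ord0 i ^+ 2
    - 2 * (enorm u * enorm v) * (u ord0 i * v ord0 i))); last by move=> i _; ring.
rewrite !big_split/= sumrN -!mulr_sumr -!sqr_enorm -/(dotp u v) => h.
rewrite -(ler_pM2l uv0); nra.
Qed.

(** The tilt of length [l] along [x].  For [x = 0] the null vector serves,
    and it is what [(l / enorm x) *: x] evaluates to. *)
Lemma exists_dual_direction (R : realType) d (l : R) (x : 'rV[R]_d) : 0 <= l ->
  exists u : 'rV[R]_d, dotp u x = l * enorm x /\
    forall y, dotp u y <= l * enorm y.
Proof.
move=> l0; pose k := l / enorm x; exists (k *: x).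
have kE y : dotp (k *: x) y = k * dotp x y.
  by rewrite /dotp mulr_sumr; apply: eq_bigr => i _; rewrite mxE mulrA.
have [x0|x0] := eqVneq (enorm x) 0.
  have k0 : k = 0 by rewrite /k x0 invr0 mulr0.
  split=> [|y]; rewrite kE k0 mul0r; first by rewrite x0 mulr0.
  by rewrite mulr_ge0// enorm_ge0.
split=> [|y]; rewrite kE.
  rewrite (_ : dotp x x = enorm x ^+ 2); last first.
    by rewrite sqr_enorm; apply: eq_bigr => i _; rewrite expr2.
  by rewrite expr2 /k mulrA divfK.
apply: le_trans (_ : k * (enorm x * enorm y) <= _).
  by rewrite ler_wpM2l ?dotp_le_enorm// divr_ge0// enorm_ge0.
by rewrite mulrA /k divfK.
Qed.

(** * Exponential tilting of convolution powers *)

(** Monotonicity with no measurability of either side: the integral of a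
    nonnegative function is a supremum over the simple functions below it.  This
    is how a pointwise bound on a convolution power passes under the integral. *)
Lemma ge0_integral_mono d (T : measurableType d) (R : realType)
    (mu : {measure set T -> \bar R}) (f g : T -> \bar R) :
  (forall x, 0 <= f x)%E -> (forall x, f x <= g x)%E ->
  (\int[mu]_x f x <= \int[mu]_x g x)%E.
Proof.
move=> f0 fg; rewrite !ge0_integralTE//; last first.
  by move=> x; exact: le_trans (fg x).
apply: ereal_sup_le => _ [h hf <-]; exists h => //= x.
exact: le_trans (fg x).
Qed.

Lemma nneseries_exp (R : realType) (z : R) : 0 <= z ->
  (\sum_(0 <= k <oo) (z ^+ k / k`!%:R)%:E = (expR z)%:E)%E.
Proof.
move=> z0; rewrite /expR -EFin_lim; last exact: is_cvg_series_exp_coeff.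
congr (limn _); apply/funext => n.
by rewrite sumEFin.
Qed.

Section chernoff.
Context (R : realType) (d : nat) (a : 'rV[R]_d -> R).
Hypothesis a_ge0 : forall x, 0 <= a x.

Lemma conv_pow_ge0 k x : (0 <= conv_pow a k x)%E.
Proof.
rewrite /conv_pow; elim: k.-1 x => [|m IH] x /=; first by rewrite lee_fin.
by apply: integral_ge0 => y _; rewrite mule_ge0// lee_fin.
Qed.

Context (u : 'rV[R]_d) (h : 'rV[R]_d -> R) (N : R).
Hypothesis mh : measurable_fun [set: _] h.
Hypothesis tilt_le : forall y, a y * expR (dotp u y) <= h y.
Hypothesis h_le : forall y, h y <= N.
Hypothesis int_h : (\int[@lebesgue_rV R d]_y (h y)%:E <= N%:E)%E.

(** One factor is bounded by the supremum and each further convolution costs a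
    factor [\int h <= N]; the exponential weight recombines because
    [- u . (x - y) = - u . x + u . y], so a pointwise bound on one power gives
    one on the next. *)
Lemma conv_pow_le_tilt k x :
  (conv_pow a k.+1 x <= (N ^+ k.+1 * expR (- dotp u x))%:E)%E.
Proof.
have h0 y : 0 <= h y by rewrite (le_trans _ (tilt_le y))// mulr_ge0// expR_ge0.
have N0 : 0 <= N := le_trans (h0 0) (h_le 0).
elim: k x => [|k IH] x.
  rewrite expr1 lee_fin; have := le_trans (tilt_le x) (h_le x).
  by rewrite -ler_pdivlMr ?expR_gt0// expRN.
rewrite (_ : conv_pow a k.+2 x = Defs.conv (conv_pow a k.+1) (EFin \o a) x)//.
apply: (@le_trans _ _ (\int[@lebesgue_rV R d]_y
    ((N ^+ k.+1 * expR (- dotp u x))%:E * (h y)%:E))%E).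
  apply: ge0_integral_mono => y /=.
    by rewrite mule_ge0 ?conv_pow_ge0// lee_fin.
  apply: (le_trans (lee_wpmul2r _ (IH (x - y)))); first by rewrite lee_fin.
  rewrite -!EFinM lee_fin -!mulrA ler_wpM2l ?exprn_ge0//.
  rewrite (_ : - dotp u (x - y) = - dotp u x + dotp u y); last first.
    rewrite /dotp -!sumrN -big_split/=; apply: eq_bigr => i _.
    by rewrite !mxE; ring.
  rewrite expRD -mulrA ler_wpM2l ?expR_ge0//.
  by rewrite mulrC.
rewrite ge0_integralZl//; first last.
- by rewrite lee_fin mulr_ge0 ?exprn_ge0// expR_ge0.
- by move=> y _; rewrite lee_fin.
- exact/measurable_EFinP.
apply: (le_trans (lee_wpmul2l _ int_h)).
  by rewrite lee_fin mulr_ge0 ?exprn_ge0// expR_ge0.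
by rewrite -EFinM lee_fin mulrAC -exprSr.
Qed.

(** The series is dominated by the exponential series of [t N].  The
    normalisation [e^{-t}] is simply bounded by [1]: when [delta > 1], a rate of
    order [t] is negligible. *)
Lemma fund_sol_reg_le_tilt x t : 0 <= t ->
  (fund_sol_reg a x t <= (expR (- (dotp u x - t * N)))%:E)%E.
Proof.
move=> t0.
have h0 y : 0 <= h y by rewrite (le_trans _ (tilt_le y))// mulr_ge0// expR_ge0.
have N0 : 0 <= N := le_trans (h0 0) (h_le 0).
pose E := expR (- dotp u x).
have termE k : (0 < k)%N -> ((t ^+ k)%:E * conv_pow a k x * (k`!%:R^-1)%:E <=
    E%:E * ((t * N) ^+ k / k`!%:R)%:E)%E.
  case: k => // k _.
  apply: (@le_trans _ _
      ((t ^+ k.+1)%:E * (N ^+ k.+1 * E)%:E * (k.+1`!%:R^-1)%:E)%E).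
    apply: lee_wpmul2r; first by rewrite lee_fin invr_ge0.
    by apply: lee_wpmul2l; rewrite ?lee_fin ?exprn_ge0//; exact: conv_pow_le_tilt.
  by rewrite -!EFinM lee_fin exprMn le_eqVlt; apply/orP; left; apply/eqP; ring.
have term0 k : (0 <= (t ^+ k)%:E * conv_pow a k x * (k`!%:R^-1)%:E)%E.
  by rewrite !mule_ge0 ?conv_pow_ge0// lee_fin ?exprn_ge0.
have z0 k : (0 <= ((t * N) ^+ k / k`!%:R)%:E)%E.
  by rewrite lee_fin divr_ge0// exprn_ge0// mulr_ge0.
have S : (\sum_(1 <= k <oo) ((t ^+ k)%:E * conv_pow a k x * (k`!%:R^-1)%:E) <=
    (E * expR (t * N))%:E)%E.
  apply: (@le_trans _ _ (\sum_(1 <= k <oo) (E%:E * ((t * N) ^+ k / k`!%:R)%:E))%E).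
    (* [termE] holds for positive [k] only; [lee_nneseries] asks for the bound
       at every index satisfying the filter. *)
    have condE (f : nat -> \bar R) :
        (\sum_(1 <= k <oo) f k = \sum_(k <oo | (0 < k)%N) f k)%E.
      exact: (eseries_cond f xpredT).
    rewrite !condE.
    by apply: lee_nneseries => //; exact: termE.
  rewrite EFinM -(@nneseries_exp _ (t * N)) ?mulr_ge0// -nneseriesZl//.
  rewrite [leRHS](@nneseries_split _ _ 0 1)//.
  by rewrite leeDr// big_nat1 -EFinM lee_fin mulr_ge0 ?expR_ge0// -lee_fin.
  by move=> k _; rewrite mule_ge0// lee_fin expR_ge0.
rewrite /fund_sol_reg; apply: (@le_trans _ _ (1%:E * (E * expR (t * N))%:E)%E).
  apply: lee_pmul; rewrite ?lee_fin ?expR_ge0//.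
    by apply: nneseries_ge0.
  by rewrite expR_le1 oppr_le0.
by rewrite mul1e lee_fin /E -expRD opprB addrC.
Qed.

End chernoff.

(** * Asymptotics along the scale *)

Section growth.
Context {R : realType}.

Lemma near_lt_ln (A : R) : \forall t \near +oo, A < ln t.
Proof.
near=> t; have t0 : 0 < t by near: t; exact: nbhs_pinfty_gt.
rewrite -[A]expRK ltr_ln ?posrE ?expR_gt0//.
Unshelve. all: by end_near. Qed.

Lemma cvgy_ln_inv : (ln t)^-1 @[t --> (+oo : set_system R)] --> (0 : R).
Proof.
apply/cvgrPdist_lt => e e0; near=> t.
have lt0 : 0 < ln t by near: t; exact: near_lt_ln.
rewrite sub0r normrN ger0_norm ?invr_ge0 ?(ltW lt0)//.
by rewrite invf_plt ?posrE//; near: t; exact: near_lt_ln.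
Unshelve. all: by end_near. Qed.

Lemma cvgy_powRN (e : R) : 0 < e ->
  t `^ (- e) @[t --> (+oo : set_system R)] --> (0 : R).
Proof.
move=> e0; apply: (@squeeze_cvgr _ _ _ _ (fun=> 0) (fun t => e^-1 * (ln t)^-1)).
- near=> t; rewrite powR_ge0/=.
  have t0 : 0 < t by near: t; exact: nbhs_pinfty_gt.
  have lt0 : 0 < ln t by near: t; exact: near_lt_ln.
  rewrite powRN -invfM lef_pV2 ?posrE ?powR_gt0 ?mulr_gt0//.
  rewrite /powR gt_eqF//.
  by apply: le_trans (expR_ge1Dx _); rewrite lerDr.
- exact: cvg_cst.
- rewrite -[X in _ --> X](mulr0 e^-1).
  by apply: cvgM; [exact: cvg_cst|exact: cvgy_ln_inv].
Unshelve. all: by end_near. Qed.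

Lemma le_exp_asymp_equiv (f : R -> \bar R) (g h : R -> R) :
  (\forall t \near +oo, g t != 0) ->
  (\forall t \near +oo, (f t <= (expR (- h t))%:E)%E) ->
  h t / g t @[t --> +oo] --> (1 : R) ->
  le_exp_asymp f g.
Proof.
move=> g0 fh hg; exists (fun t => h t / g t - 1); split.
  by rewrite -(subrr (1 : R)); apply: cvgB => //; exact: cvg_cst.
near=> t; rewrite addrC subrK mulrC divfK; first by near: t.
by near: t.
Unshelve. all: by end_near. Qed.

End growth.

(** The tilting bound along [on_scale], with tilt [kappa (ln t)^theta].  The
    hypothesis on [a] is written with [L] in place of [ln t], so that
    [expR (s * L)] is [t `^ s]; the limit hypothesis says that the cost [t N] of
    the tilt is negligible compared with its gain. *)
Lemma le_exp_asymp_fund_sol (R : realType) d (a w : 'rV[R]_d -> R)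
    (delta r kappa theta s C : R) (g : R -> R) (x : R -> 'rV[R]_d) :
  0 < r -> 0 < kappa ->
  (forall y, 0 <= a y) ->
  measurable_fun [set: 'rV[R]_d] w ->
  (forall y, w y <= C) ->
  (\int[@lebesgue_rV R d]_y (w y)%:E <= C%:E)%E ->
  (forall L y, 1 <= L ->
    a y * expR (kappa * L `^ theta * enorm y) <= expR (s * L) * w y) ->
  t `^ (1 + s) / (t `^ ((delta + 1) / 2) * ln t `^ theta)
    @[t --> +oo] --> (0 : R) ->
  (\forall t \near +oo, g t = kappa * r * t `^ ((delta + 1) / 2) * ln t `^ theta) ->
  on_scale delta r x ->
  le_exp_asymp (fun t => fund_sol_reg a (x t) t) g.
Proof.
move=> r0 k0 a0 mw wC iw aw lim0 gE xr.
have w0 y : 0 <= w y.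
  rewrite -(@pmulr_rge0 _ (expR (s * 1))) ?expR_gt0//.
  by apply: le_trans (aw 1 y (lexx _)); rewrite mulr_ge0// expR_ge0.
pose h t := kappa * ln t `^ theta * enorm (x t) - C * t `^ (1 + s).
apply: (@le_exp_asymp_equiv _ _ _ h).
- near=> t.
  rewrite (_ : g t = kappa * r * t `^ ((delta + 1) / 2) * ln t `^ theta); last by near: t.
  have t0 : 0 < t by near: t; exact: nbhs_pinfty_gt.
  have lt0 : 0 < ln t by near: t; exact: near_lt_ln.
  by rewrite !mulf_neq0// ?gt_eqF// powR_gt0.
- near=> t.
  have t0 : 0 < t by near: t; exact: nbhs_pinfty_gt.
  have lt1 : 1 <= ln t by apply: ltW; near: t; exact: near_lt_ln.
  have tsE : t `^ s = expR (s * ln t) by rewrite /powR gt_eqF.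
  have l0 : 0 <= kappa * ln t `^ theta by rewrite mulr_ge0 ?(ltW k0)// powR_ge0.
  have [u [ux uy]] := exists_dual_direction _ _ _ (x t) l0.
  rewrite /h -ux powRD ?(gt_eqF t0) ?implybT// powRr1 ?(ltW t0)// mulrCA.
  apply: (@fund_sol_reg_le_tilt _ _ _ a0 u (fun y => t `^ s * w y)).
  + exact: measurable_funM.
  + move=> y; rewrite tsE; apply: le_trans (aw _ y lt1).
    by rewrite ler_wpM2l// ler_expR.
  + by move=> y; rewrite mulrC ler_wpM2r ?powR_ge0.
  + under eq_integral do rewrite EFinM.
    rewrite ge0_integralZl//; first last.
    * by rewrite lee_fin powR_ge0.
    * by move=> y _; rewrite lee_fin.
    * exact/measurable_EFinP.
    by rewrite (mulrC C) EFinM lee_wpmul2l// lee_fin powR_ge0.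
  + exact: ltW.
- (* [h t / g t] is the gain of the tilt, tending to [1], minus its cost. *)
  have : r^-1 * (t `^ (- ((1 + delta) / 2)) * enorm (x t))
     - C / (kappa * r) * (t `^ (1 + s) / (t `^ ((delta + 1) / 2) * ln t `^ theta))
     @[t --> +oo] --> r^-1 * r - C / (kappa * r) * 0.
    by apply: cvgB; apply: cvgM => //; exact: cvg_cst.
  rewrite mulr0 subr0 mulVf ?gt_eqF//; apply: cvg_trans; apply: near_eq_cvg.
  near=> t.
  rewrite (_ : g t = kappa * r * t `^ ((delta + 1) / 2) * ln t `^ theta); last by near: t.
  have t0 : 0 < t by near: t; exact: nbhs_pinfty_gt.
  have lt0 : 0 < ln t by near: t; exact: near_lt_ln.
  rewrite /h powRN (addrC 1 delta).
  have := powR_gt0 ((delta + 1) / 2) t0; have := powR_gt0 theta lt0.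
  set T := t `^ _; set L := _ `^ _ => L0 T0.
  by field; rewrite !gt_eqF.
Unshelve. all: by end_near. Qed.

(** * The envelope for exponentially decaying kernels *)

Lemma integral_expN_norm_lty (R : realType) (c : R) : 0 < c ->
  (\int[@lebesgue_measure R]_x (expR (- c * `|x|))%:E < +oo)%E.
Proof.
move=> c0; rewrite ge0_symfun_integralT; first last.
- by move=> x /=; rewrite normrN.
- move=> x; apply: continuous_comp; last exact: continuous_expR.
  by apply: continuousM; [exact: cst_continuous|exact: norm_continuous].
- by move=> x; exact: expR_ge0.
have mpos : measurable [set x : R | 0 <= x] by rewrite -set_itvcy.
rewrite lte_mul_pinfty//.
under eq_integral => x /[!inE]/= x0.
  rewrite (_ : expR _ = c^-1 * exponential_pdf c x).
    rewrite EFinM; over.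
  by rewrite exponential_pdfE// ger0_norm// mulKf// gt_eqF.
apply: (@le_lt_trans _ _ (\int[@lebesgue_measure R]_x
    ((c^-1)%:E * (exponential_pdf c x)%:E))%E).
  apply: ge0_subset_integral => //.
    apply: measurable_funeM; apply/measurable_EFinP.
    exact: measurable_exponential_pdf.
  move=> x _; rewrite -EFinM lee_fin mulr_ge0 ?invr_ge0 ?(ltW c0)//.
  exact/exponential_pdf_ge0/ltW.
rewrite ge0_integralZl//; first last.
- by rewrite lee_fin invr_ge0 ltW.
- by move=> x _; rewrite lee_fin exponential_pdf_ge0// ltW.
- by apply/measurable_EFinP; exact: measurable_exponential_pdf.
by rewrite integral_exponential_pdf// mule1 ltry.
Qed.

Lemma measurable_expN_norm1 (R : realType) n (c : R) :
  measurable_fun [set: 'rV[R]_n]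
    (fun x : 'rV[R]_n => expR (- c * \sum_(i < n) `|x ord0 i|)).
Proof.
apply: measurableT_comp => //; apply: measurable_funM => //.
apply: measurable_sum => i; apply: measurableT_comp => //.
exact: measurable_coord.
Qed.

(** The [l^1] norm is used because its exponential factorises over the
    coordinates, so that Tonelli reduces the integral to dimension one. *)
Lemma integral_expN_norm1_lty (R : realType) n (c : R) : 0 < c ->
  (\int[@lebesgue_rV R n]_x (expR (- c * \sum_(i < n) `|x ord0 i|))%:E < +oo)%E.
Proof.
move=> c0; elim: n => [|n IH].
  rewrite integral_dirac//; last by apply/measurable_EFinP; exact: measurable_expN_norm1.
  by rewrite diracT mul1e ltry.
have mE m := (measurable_EFinP _ _).2 (@measurable_expN_norm1 R m c).
rewrite /= ge0_integral_pushforward//; last exact: measurable_cons_rV.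
rewrite preimage_setT.
rewrite fubini_tonelli1; first last.
- by move=> y; rewrite lee_fin expR_ge0.
- by apply: measurableT_comp; [exact: mE | exact: measurable_cons_rV].
rewrite /fubini_F.
under eq_integral => x _.
  under eq_integral => v _ /=.
    rewrite big_ord_recl mulrDr expRD EFinM {1}/cons_rV mxE unlift_none/=.
    under eq_bigr do rewrite mxE liftK/=.
    over.
  rewrite ge0_integralZl//=.
  over.
rewrite ge0_integralZr//; first last.
- by apply: integral_ge0 => y _; rewrite lee_fin expR_ge0.
- apply/measurable_EFinP; apply: measurableT_comp => //.
  by apply: measurable_funM => //; exact: measurableT_comp.
rewrite lte_mul_pinfty//.
- by apply: integral_ge0 => y _; rewrite lee_fin expR_ge0.
- rewrite ge0_fin_numE; first exact: integral_expN_norm_lty.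
  by apply: integral_ge0 => y _; rewrite lee_fin expR_ge0.
Qed.

(** The two terms on the right balance at [q = L^(1/p)]: below it, the left side
    is at most [min s b * L], and above it at most [min s b * q^p].  Unlike
    the inequality with conjugate exponents, this includes [p = 1]. *)
Lemma young_min (R : realType) (b s p L q : R) :
  0 < b -> 0 < s -> 1 <= p -> 1 <= L -> 0 <= q ->
  Num.min s b * L `^ ((p - 1) / p) * q <= s * L + b * q `^ p.
Proof.
move=> b0 s0 p1 L1 q0.
have p0 : 0 < p by lra.
have m0 : 0 <= Num.min s b by rewrite le_min !ltW.
have L0 : 0 < L by lra.
have LE : L `^ ((p - 1) / p) * L `^ p^-1 = L.
  rewrite -powRD ?(gt_eqF L0) ?implybT// (_ : _ + _ = 1) ?powRr1 ?(ltW L0)//.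
  by field; rewrite gt_eqF.
have [qL|Lq] := leP q (L `^ p^-1).
  apply: (@le_trans _ _ (Num.min s b * L)).
    by rewrite -[in leRHS]LE mulrA ler_wpM2l// mulr_ge0// powR_ge0.
  apply: (@le_trans _ _ (s * L)); last by rewrite lerDl mulr_ge0 ?powR_ge0 ?ltW.
  by rewrite ler_wpM2r ?(ltW L0)// ge_min lexx.
apply: (@le_trans _ _ (Num.min s b * q `^ p)).
  rewrite -mulrA ler_wpM2l// -(mulr_powRB1 q0 p0) mulrC ler_wpM2l//.
  rewrite mulrC powRrM ge0_ler_powR ?nnegrE ?powR_ge0//; last exact: ltW.
  by rewrite subr_ge0.
apply: (@le_trans _ _ (b * q `^ p)); last by rewrite lerDr mulr_ge0 ?ltW.
by rewrite ler_wpM2r ?powR_ge0// ge_min lexx orbT.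
Qed.

(** Half of the decay rate absorbs the tilt through [young_min]; the other half
    yields the envelope, after the lower bounds [q^p >= q - 1] and
    [|y| >= (1/d) (|y_1| + ... + |y_d|)]. *)
Lemma exp_decay_tilt_le (R : realType) d (a : 'rV[R]_d -> R) (C1 b p s L : R) y :
  0 < C1 -> 0 < b -> 1 <= p -> 0 < s -> 1 <= L -> exp_decay a C1 b p ->
  a y * expR (Num.min s (b / 2) * L `^ ((p - 1) / p) * enorm y) <=
  expR (s * L) *
    (C1 * expR (b / 2) * expR (- (b / 2 / d%:R) * \sum_(i < d) `|y ord0 i|)).
Proof.
move=> C10 b0 p1 s0 L1 /(_ y)/andP[ay0 ay].
have b20 : 0 < b / 2 by lra.
have q0 := @enorm_ge0 _ _ y; set q := enorm y in q0 ay *.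
have Sq : b / 2 / d%:R * \sum_(i < d) `|y ord0 i| <= b / 2 * q.
  rewrite -mulrA ler_wpM2l ?(ltW b20)//.
  have [->|d0] := eqVneq (d%:R : R) 0; first by rewrite invr0 mul0r.
  by rewrite ler_pdivrMl ?lt_def ?d0 ?ler0n// sum_coord_le_enorm.
have qp : q <= 1 + q `^ p.
  have [q1|q1] := leP q 1; first by rewrite ler_wpDr// powR_ge0.
  by apply: le_trans (le1r_powR (ltW q1) p1) _; rewrite lerDr.
have bqp : b / 2 * q <= b / 2 * (1 + q `^ p) by rewrite ler_wpM2l// ltW.
have := @young_min R (b / 2) s p L q b20 s0 p1 L1 q0.
set E := Num.min _ _ * _ * _ => Eq.
apply: le_trans (ler_wpM2r (expR_ge0 E) ay) _.
rewrite (_ : expR (s * L) * _ = C1 * (expR (s * L) * (expR (b / 2) *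
  expR (- (b / 2 / d%:R) * \sum_(i < d) `|y ord0 i|)))); last by ring.
rewrite -[leLHS]mulrA ler_wpM2l ?(ltW C10)// -!expRD ler_expR; lra.
Qed.

(** Here [s = (delta - 1) / 4] is half of the threshold [(delta - 1) / 2], which
    leaves a factor [t^(-s)] in the cost of the tilt. *)
Lemma fund_sol_exp_decay (R : realType) d (a : 'rV[R]_d -> R)
    (delta C1 b p r : R) (x : R -> 'rV[R]_d) :
  1 < delta -> (0 < d)%N -> 0 < C1 -> 0 < b -> 1 <= p -> 0 < r ->
  exp_decay a C1 b p -> on_scale delta r x ->
  le_exp_asymp (fun t => fund_sol_reg a (x t) t)
    (fun t => Num.min ((delta - 1) / 4) (b / 2) * r *
              t `^ ((delta + 1) / 2) * ln t `^ ((p - 1) / p)).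
Proof.
move=> d1 d0 C10 b0 p1 r0 decay xr.
have s0 : 0 < (delta - 1) / 4 by lra.
set s := (delta - 1) / 4 in s0 *.
pose w (y : 'rV[R]_d) :=
  C1 * expR (b / 2) * expR (- (b / 2 / d%:R) * \sum_(i < d) `|y ord0 i|).
have c0 : 0 < b / 2 / d%:R by rewrite !divr_gt0// ltr0n.
have K0 : 0 <= C1 * expR (b / 2) by rewrite mulr_ge0 ?expR_ge0// ltW.
pose J := (\int[@lebesgue_rV R d]_y
  (expR (- (b / 2 / d%:R) * \sum_(i < d) `|y ord0 i|))%:E)%E.
have Jfin : J \is a fin_num.
  rewrite ge0_fin_numE; first exact: integral_expN_norm1_lty.
  by apply: integral_ge0 => y _; rewrite lee_fin expR_ge0.
apply: (@le_exp_asymp_fund_sol _ _ a w delta r (Num.min s (b / 2))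
  ((p - 1) / p) s (C1 * expR (b / 2) * Num.max 1 (fine J))) => //.
- by rewrite lt_min s0 divr_gt0.
- by move=> y; have /andP[] := decay y.
- by apply: measurable_funM => //; exact: measurable_expN_norm1.
- move=> y; rewrite ler_wpM2l// le_max expR_le1 mulNr oppr_le0.
  by rewrite mulr_ge0 ?(ltW c0)// sumr_ge0.
- under eq_integral do rewrite EFinM.
  rewrite ge0_integralZl//; last first.
    by apply/measurable_EFinP; exact: measurable_expN_norm1.
  by rewrite [leRHS]EFinM lee_wpmul2l// -/J -{1}(fineK Jfin) lee_fin le_max lexx orbT.
- by move=> L y L1; exact: exp_decay_tilt_le.
- apply: (@squeeze_cvgr _ _ _ _ (fun=> 0) (fun t => t `^ (- s)));
    [|exact: cvg_cst|exact: cvgy_powRN].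
  near=> t.
  have t0 : 0 < t by near: t; exact: nbhs_pinfty_gt.
  have lt1 : 1 <= ln t by apply: ltW; near: t; exact: near_lt_ln.
  have L1 : 1 <= ln t `^ ((p - 1) / p).
    by rewrite -[leLHS](powRr0 (ln t)) ler_powR// divr_ge0//; lra.
  rewrite divr_ge0 ?mulr_ge0 ?powR_ge0//=.
  rewrite ler_pdivrMr ?mulr_gt0 ?powR_gt0//; last lra.
  rewrite mulrA -powRD ?(gt_eqF t0) ?implybT//.
  rewrite (_ : - s + (delta + 1) / 2 = 1 + s); last by rewrite /s; field.
  by rewrite ler_peMr// powR_ge0.
- by near=> t.
Unshelve. all: by end_near. Qed.

(** The tilt [(delta - 1) / (2 mu) * ln t] multiplies [a] by at most
    [t^((delta - 1) / 2)] on its support, so its cost is of order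
    [t^((delta + 1) / 2)], which is smaller than its gain by a factor [ln t]. *)
Lemma fund_sol_bounded_supp (R : realType) d (a : 'rV[R]_d -> R)
    (delta K mu r : R) (x : R -> 'rV[R]_d) :
  1 < delta -> 0 < mu -> 0 < r ->
  (forall y, 0 <= a y <= K) -> measurable_fun [set: 'rV[R]_d] a ->
  (\int[@lebesgue_rV R d]_y (a y)%:E = 1)%E ->
  (forall y, a y != 0 -> enorm y <= mu) -> on_scale delta r x ->
  le_exp_asymp (fun t => fund_sol_reg a (x t) t)
    (fun t => (delta - 1) * r / (2 * mu) * t `^ ((delta + 1) / 2) * ln t).
Proof.
move=> d1 mu0 r0 aK ma a1 supp_mu xr.
apply: (@le_exp_asymp_fund_sol _ _ a a delta r ((delta - 1) / (2 * mu)) 1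
  ((delta - 1) / 2) (Num.max 1 K)) => //.
- by rewrite divr_gt0//; lra.
- by move=> y; have /andP[] := aK y.
- by move=> y; have /andP[_ ayK] := aK y; rewrite le_max ayK orbT.
- by rewrite a1 lee_fin le_max lexx.
- move=> L y L1; rewrite powRr1; last lra.
  have [->|ay] := eqVneq (a y) 0; first by rewrite mul0r mulr0.
  have /andP[ay0 _] := aK y.
  rewrite mulrC ler_wpM2r// ler_expR.
  rewrite (_ : (delta - 1) / 2 * L = (delta - 1) / (2 * mu) * L * mu).
    by rewrite ler_wpM2l ?supp_mu// mulr_ge0 ?divr_ge0//; lra.
  by field; rewrite gt_eqF.
- apply: cvg_trans cvgy_ln_inv; apply: near_eq_cvg; near=> t.
  have t0 : 0 < t by near: t; exact: nbhs_pinfty_gt.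
  have lt0 : 0 < ln t by near: t; exact: near_lt_ln.
  rewrite (_ : 1 + (delta - 1) / 2 = (delta + 1) / 2); last by field.
  by rewrite powRr1 ?(ltW lt0)// invfM mulrA divff ?mul1r// gt_eqF// powR_gt0.
- near=> t; rewrite powRr1; first by field; rewrite gt_eqF.
  by apply: ltW; near: t; exact: near_lt_ln.
Unshelve. all: by end_near. Qed.

Theorem theorem3p2 (R : realType) (delta : R) (hdelta : 1 < delta) :
  (exists c : R -> R -> R -> R,
    (forall b r p : R, 0 < b -> 0 < r -> 1 <= p -> 0 < c b r p) /\
    forall (d : nat) (a : 'rV[R]_d -> R) (C1 b p r : R) (x : R -> 'rV[R]_d),
      (0 < d)%N -> 0 < C1 -> 0 < b -> 1 <= p -> 0 < r ->
      jump_density a -> exp_decay a C1 b p -> on_scale delta r x ->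
      le_exp_asymp (fun t => fund_sol_reg a (x t) t)
        (fun t => c b r p * t `^ ((delta + 1) / 2) * ln t `^ ((p - 1) / p))) /\
  (forall (d : nat) (a : 'rV[R]_d -> R) (C1 b p mu r : R) (x : R -> 'rV[R]_d),
      (0 < d)%N -> 0 < C1 -> 0 < b -> 1 <= p -> 0 < r ->
      jump_density a -> exp_decay a C1 b p ->
      C0 a -> 0 < mu -> supp_radius a mu -> on_scale delta r x ->
      le_exp_asymp (fun t => fund_sol_reg a (x t) t)
        (fun t => (delta - 1) * r / (2 * mu) * t `^ ((delta + 1) / 2) * ln t)).
Proof.
split.
  exists (fun b r p => Num.min ((delta - 1) / 4) (b / 2) * r); split.
    by move=> b r p b0 r0 _; rewrite mulr_gt0// lt_min; apply/andP; split; lra.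
  by move=> d a C1 b p r x d0 C10 b0 p1 r0 _ decay; apply: (@fund_sol_exp_decay _ _ _ _ C1).
move=> d a C1 b p mu r x d0 C10 b0 p1 r0 ja decay _ mu0 [supp_mu _] xr.
apply: (@fund_sol_bounded_supp _ _ a delta C1) => //.
- move=> y; have /andP[-> ay] := decay y; apply: le_trans ay _.
  rewrite ler_piMr ?(ltW C10)// expR_le1 mulNr oppr_le0.
  by rewrite mulr_ge0 ?powR_ge0// ltW.
- by have /sub_Lfun_mfun := jump_L1 ja; rewrite inE.
- exact: jump_int.
- by move=> y ay; apply: supp_mu; exact: subset_closure.
Qed.
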